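(* Let $(E,d)$ be a Polish space with Borel $\sigma$-field $\mathcal{E}$, and let $(P_t)_{t\in\mathbb{R}_+}$ be a Markov semigroup on $E$ with transition function $\{P_t(x,A)\}$. Suppose that there exist non-decreasing functions $F_1,F_2\colon\mathbb{R}_+\to\mathbb{R}_+$, a non-increasing function $r\colon\mathbb{R}_+\to\mathbb{R}_+$ with $\lim_{t\to\infty}r(t)=0$, and a point $x_0\in E$ such that for every $x,y\in E$ and every $t\in\mathbb{R}_+$ there exist $E$-valued random variables $Y^{x,y}_t$ and $Z^{x,y}_t$ on a common probability space with the following properties: 1. $\mathrm{Law}(Y^{x,y}_t)=P_t(y,\cdot)$ and $d_{TV}\big(\mathrm{Law}(Z^{x,y}_t),P_t(x,\cdot)\big)\le F_1\big(d(x,x_0)\vee d(y,x_0)\big)\,d(x,y)$; 2. $\mathsf{E}\, d(Z^{x,y}_t,Y^{x,y}_t)\le F_2\big(d(x,x_0)\vee d(y,x_0)\big)\,r(t)\,d(x,y)$. Then $(P_t)_{t\in\mathbb{R}_+}$ satisfies the property ASF+ with the function $F:=2F_1+F_2$ (and hence $(P_t)_{t\in\mathbb{R}_+}$ is asymptotically strong Feller, i.e. satisfies ASF).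
   Context: Notation: $\mathbb{R}_+=[0,\infty)$, $\mathbb{N}=\{1,2,\dots\}$, $\mathbb{Z}_+=\{0,1,2,\dots\}$, $a\vee b=\max(a,b)$. $\mathcal{P}(E)$ is the set of Borel probability measures on $E$. Write $P_t\varphi(x)=\int_E\varphi(z)\,P_t(x,\mathrm{d}z)$ and $\|\varphi\|_\infty=\sup_{x}|\varphi(x)|$. The semigroup is Feller if for every $t\ge 0$, $P_t\varphi$ is continuous for every bounded continuous $\varphi\colon E\to\mathbb{R}$. The total variation distance is $d_{TV}(\mu,\nu)=\sup_{A\in\mathcal{E}}|\mu(A)-\nu(A)|$. For $\mu,\nu\in\mathcal{P}(E)$, $\mathscr{C}(\mu,\nu)$ is the set of all couplings, i.e. probability measures on $E\times E$ with marginals $\mu$ and $\nu$; for measurable $\rho\colon E\times E\to\mathbb{R}_+$, $W_\rho(\mu,\nu)=\inf_{\gamma\in\mathscr{C}(\mu,\nu)}\int_{E\times E}\rho(x,y)\,\gamma(\mathrm{d}x,\mathrm{d}y)$. ASF+ (Asymptotic Strong Feller Plus Property): $(P_t)_{t\in\mathbb{R}_+}$ satisfies ASF+ with a non-decreasing function $F\colon[0,\infty)\to[0,\infty)$ if it is Feller and there exist $x_0\in E$, a non-decreasing sequence $(t_n)_{n\in\mathbb{Z}_+}$ in $\mathbb{R}_+$, and a positive sequence $(\delta_n)_{n\in\mathbb{Z}_+}$ with $\delta_n\searrow 0$ as $n\to\infty$, such that for every $d$-Lipschitz continuous function $\varphi\colon E\to\mathbb{R}$ with Lipschitz constant $K>0$,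 $$|P_{t_n}\varphi(x)-P_{t_n}\varphi(y)|\le d(x,y)\,F\big(d(x,x_0)\vee d(y,x_0)\big)\,\big(\|\varphi\|_\infty+\delta_nK\big)$$ for every $n\in\mathbb{N}$ and $x,y\in E$. (When $\|\varphi\|_\infty=\infty$ the inequality is regarded as vacuously true, so only bounded $\varphi$ matter.) The semigroup satisfies ASF+ if it satisfies it with some such $F$. A pseudo-metric on $E$ satisfies all properties of a metric except possibly that $\rho(x,y)=0$ implies $x=y$. An increasing sequence $(d_n)_{n\in\mathbb{Z}_+}$ of bounded continuous pseudo-metrics on $E$ is totally separating if $\lim_{n\to\infty}d_n(x,y)=1$ for all $x\ne y$ in $E$. ASF (Asymptotic Strong Feller Property): $(P_t)_{t\in\mathbb{R}_+}$ satisfies ASF (is asymptotically strong Feller) if it is Feller and for every $x\in E$ there exist a sequence of positive real numbers $(t_n)_{n\in\mathbb{Z}_+}$ and a totally separating sequence $(d_n)_{n\in\mathbb{Z}_+}$ of pseudo-metrics such that $$\inf_{U\in\mathcal{U}_x}\ \limsup_{n\to\infty}\ \sup_{y\in U}W_{d_n}\big(P_{t_n}(x,\cdot),P_{t_n}(y,\cdot)\big)=0,$$ where $\mathcal{U}_x$ is the collection of all open neighborhoods of $x$. *)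

(* Defs.v *)
From HB Require Import structures.
From mathcomp Require Import all_boot all_order all_algebra.
From mathcomp Require Import all_classical all_reals all_analysis.

Set Implicit Arguments.
Unset Strict Implicit.
Unset Printing Implicit Defensive.

Import Order.TTheory GRing.Theory Num.Theory.
Import numFieldNormedType.Exports.

Local Open Scope classical_set_scope.
Local Open Scope ring_scope.

HB.mixin Record isPolish (d : measure_display) (R : realType) E
    & Metric R E & Complete E & Measurable d E := {
  polish_separable : exists2 D : set E, countable D & dense D ;
  polish_borel : @measurable d E = <<s [set U : set E | open U] >>
}.

(* Separable metric space, complete for its distance [mdist], with its Borel
   sigma-algebra as measurable structure. *)
#[short(type="polishSpaceType")]
HB.structure Definition PolishSpace (d : measure_display) (R : realType) :=
  { E of Metric R E & Complete E & Measurable d E & isPolish d R E }.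

Section asymptotic_strong_feller.
Context {R : realType} {d : measure_display} {E : polishSpaceType d R}.

(* Functions on R_+ are represented by functions on R, about which nothing is
   required or asserted at negative arguments; the same convention is used for
   the time index of [P]. *)
Definition nonneg_nondecreasing (F : R -> R) :=
  (forall u : R, 0 <= u -> 0 <= F u) /\
  (forall u v : R, 0 <= u -> u <= v -> F u <= F v).

Definition nonneg_nonincreasing (F : R -> R) :=
  (forall u : R, 0 <= u -> 0 <= F u) /\
  (forall u v : R, 0 <= u -> u <= v -> F v <= F u).

Definition markov_semigroup (P : R -> R.-pker E ~> E) :=
  (forall x A, measurable A -> P 0 x A = \d_x A) /\
  (forall (s t : R) x A, 0 <= s -> 0 <= t -> measurable A ->
    P (s + t) x A = (\int[P s x]_z P t z A)%E).

Definition semigroup_op (P : R -> R.-pker E ~> E) (t : R) (phi : E -> R)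
  (x : E) : R := (\int[P t x]_z phi z)%R.

Definition feller (P : R -> R.-pker E ~> E) :=
  forall t : R, 0 <= t -> forall phi : E -> R,
    bounded_fun phi -> continuous phi -> continuous (semigroup_op P t phi).

(* Real-valued supremum, only meaningful for bounded [phi]. *)
Definition sup_norm (phi : E -> R) : R := sup (range (fun x => `|phi x|)).

Definition lipschitz_with (K : R) (phi : E -> R) :=
  forall x y, `|phi x - phi y| <= K * mdist x y.

Definition total_variation_distance (mu nu : {measure set E -> \bar R}) :
  \bar R := ereal_sup [set `|mu A - nu A|%E | A in measurable].

Definition couplings (mu nu : {measure set E -> \bar R}) :
    set (probability (E * E)%type R) :=
  [set gamma | forall A, measurable A ->
    gamma (A `*` [set: E]) = mu A /\ gamma ([set: E] `*` A) = nu A].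

Definition wasserstein (rho : E -> E -> R) (mu nu : {measure set E -> \bar R}) :
  \bar R := ereal_inf [set (\int[gamma]_p (rho p.1 p.2)%:E)%E
                      | gamma in couplings mu nu].

Definition asf_plus_with (P : R -> R.-pker E ~> E) (F : R -> R) :=
  nonneg_nondecreasing F /\ feller P /\
  exists (x0 : E) (t delta : R ^nat),
    [/\ (forall n, 0 <= t n) /\ nondecreasing_seq t,
        (forall n, 0 < delta n) /\ nonincreasing_seq delta,
        delta n @[n --> \oo] --> (0 : R) &
        forall (phi : E -> R) (K : R),
          0 < K -> lipschitz_with K phi -> bounded_fun phi ->
          forall n, (1 <= n)%N -> forall x y,
          `|semigroup_op P (t n) phi x - semigroup_op P (t n) phi y| <=
            mdist x y * F (Num.max (mdist x x0) (mdist y x0)) *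
            (sup_norm phi + delta n * K)].

Definition pseudo_metric (rho : E -> E -> R) :=
  [/\ forall x y, 0 <= rho x y, forall x, rho x x = 0,
      forall x y, rho x y = rho y x &
      forall x y z, rho x z <= rho x y + rho y z].

Definition totally_separating (dn : nat -> E -> E -> R) :=
  [/\ forall n, pseudo_metric (dn n),
      forall n, bounded_fun (fun p : E * E => dn n p.1 p.2),
      forall n, continuous (fun p : E * E => dn n p.1 p.2),
      forall x y, nondecreasing_seq (fun n => dn n x y) &
      forall x y, x != y -> dn n x y @[n --> \oo] --> (1 : R)].

Definition asf (P : R -> R.-pker E ~> E) :=
  feller P /\
  forall x : E, exists (t : R ^nat) (dn : nat -> E -> E -> R),
    [/\ forall n, 0 < t n, totally_separating dn &
        ereal_inf [set limn_esup (fun n =>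
            ereal_sup [set wasserstein (dn n) (P (t n) x) (P (t n) y)
                      | y in U])
          | U in open_nbhs x] = 0%E].

End asymptotic_strong_feller.

(* Main.v *)
Require Import Defs.
From mathcomp Require Import all_boot all_order all_algebra.
From mathcomp Require Import all_classical all_reals all_analysis.
From mathcomp Require Import measurable_realfun.
From mathcomp Require Import ring lra.

Set Implicit Arguments.
Unset Strict Implicit.
Unset Printing Implicit Defensive.

Import Order.TTheory GRing.Theory Num.Theory.
Import numFieldNormedType.Exports.

Local Open Scope classical_set_scope.
Local Open Scope ring_scope.

(** Everything rests on turning the two approximate copies into one genuine
coupling. The law of Z is close in total variation to P_t(x,.), so Z can be
replaced, on an event of probability at most that distance, by an independent
sample drawn from what P_t(x,.) has in excess of the law of Z; the result X has
law exactly P_t(x,.) and agrees with Z off that event ([replace_law]). On the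
event a cost is bounded by its supremum a, and off the event d(X,Y) = d(Z,Y), so
the law of (X,Y) is a coupling of P_t(x,.) and P_t(y,.) under which every
truncated distance min(a, b d) has expectation at most
a F1 d(x,y) + b F2 r(t) d(x,y) ([coupling_of_near_copies]). This single estimate
gives the three parts of the conclusion.

- The inequality of ASF+: a bounded K-Lipschitz phi satisfies
  |phi u - phi v| <= min(2 |phi|, K d(u,v)).
- The Feller property: for phi bounded by M and continuous,
  |phi u - phi v| <= e + 2 M 1_B(u) + min(2 M, 2 M (k+1) d(u,v)), where B is the
  open set of points at which phi varies by more than e within distance 1/(k+1).
  Since B shrinks to the empty set, P_t(x,B) is small for large k, and this
  involves the fixed point x only; the last term is then small for y near x.
- ASF: along the times n+1 the truncated distances min(1, d / e_n), with e_n
  decreasing to 0 and above r(n+1), are totally separating, and the coupling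
  bounds the corresponding Wasserstein distance by (F1 + F2) d(x,y) for all n. *)

(** * The overlap of two probability measures *)

Section overlap_of_measures.
Local Open Scope ereal_scope.
Context {R : realType} {d : measure_display} {T : measurableType d}.

(** A Radon-Nikodym density g of m need only be at most 1 almost everywhere, but
truncating it at 1 does no harm: on {g > 1} the truncation integrates to nu,
which is at least m. *)
Lemma dominated_density_le1 (nu : {finite_measure set T -> \bar R})
    (m : {measure set T -> \bar R}) :
  (forall A, measurable A -> m A <= nu A) ->
  exists f : T -> R, [/\ measurable_fun setT f,
    forall x, (0 <= f x <= 1)%R &
    forall A, measurable A -> m A = \int[nu]_(x in A) (f x)%:E].
Proof.
move=> mnu.
have mT : m setT < +oo.
  by rewrite (le_lt_trans (mnu _ measurableT))// ltey_eq fin_num_measure.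
pose m' : {finite_measure set T -> \bar R} := mfrestr measurableT mT.
have m'E A : m' A = m A by rewrite /m'/= /mfrestr/= /mrestr setIT.
have m'nu : m' `<< nu.
  apply/null_content_dominatesP => A mA nuA0; apply/eqP.
  by rewrite eq_le measure_ge0 andbT -nuA0 (le_trans _ (mnu A mA))// -m'E.
have [g [g0 gfin gint g'E]] := radon_nikodym_sigma_finite m'nu.
have gE A : measurable A -> m A = \int[nu]_(x in A) g x.
  by move=> mA; rewrite -m'E g'E.
have mg : measurable_fun setT g by exact: (measurable_int nu).
pose f x := Num.min (fine (g x)) 1%R.
have mf : measurable_fun setT f.
  by apply: measurable_minr => //; exact: measurableT_comp.
have f01 x : (0 <= f x <= 1)%R.
  by rewrite /f ge_min lexx orbT andbT le_min ler01 andbT fine_ge0.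
exists f; split => // A mA.
have fA B : measurable_fun B (fun x => (f x)%:E).
  exact/measurable_EFinP/measurable_funTS.
have f0 x : 0 <= (f x)%:E by rewrite lee_fin; case/andP: (f01 x).
apply/eqP; rewrite eq_le; apply/andP; split; last first.
  rewrite (gE A mA); apply: ge0_le_integral => //; first exact: measurable_funTS.
  by move=> x _; rewrite -[leRHS]fineK// lee_fin /f ge_min lexx.
pose B := [set x | 1 < g x].
have mB : measurable B.
  by rewrite /B -[X in measurable X]setTI; exact: emeasurable_fun_o_infty.
rewrite -(setUIDK A B) measureU//; last 3 first.
- exact: measurableI.
- exact: measurableD.
- by apply/seteqP; split => x // [[_ ?] []].
rewrite ge0_integral_setU//; last 3 first.
- exact: measurableI.
- exact: measurableD.
- by apply/disj_setPS => x [[_ ?] []].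
apply: leeD.
  rewrite (le_trans (mnu _ _))//; first exact: measurableI.
  rewrite -[leLHS]mul1e -integral_cst//; last exact: measurableI.
  apply: ge0_le_integral => //; first exact: measurableI.
  move=> x [_]; rewrite /B/= => g1; rewrite lee_fin /f le_min lexx andbT.
  by rewrite -lee_fin fineK// ltW.
have mAB : measurable (A `\` B) by exact: measurableD.
apply: (@le_trans _ _ (\int[nu]_(x in A `\` B) g x)); first by rewrite -gE.
apply: ge0_le_integral => //; first exact: measurable_funTS.
move=> x [_]; rewrite /B/= => /negP; rewrite -leNgt => g1.
rewrite -[leLHS]fineK// lee_fin /f le_min lexx/=.
by rewrite -lee_fin fineK.
Qed.

(** The overlap of mu and nu, equal to mu where nu - mu is nonnegative and to nu
elsewhere, is dominated by both, hence has a density f with respect to nu; the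
remainder of mu is the negative part of nu - mu, normalized to rho. Its mass is
nu S - mu S for a Hahn set S, a quantity that total variation controls. *)
Lemma overlap_decomposition (mu nu : probability T R) :
  exists (f : T -> R) (rho : probability T R), [/\ measurable_fun setT f,
    forall x, (0 <= f x <= 1)%R,
    forall A, measurable A -> mu A =
      \int[nu]_(x in A) (f x)%:E + (1 - \int[nu]_x (f x)%:E) * rho A &
    exists2 S, measurable S & 1 - \int[nu]_x (f x)%:E = nu S - mu S].
Proof.
pose chi : {charge set T -> \bar R} := cadd (charge_of_finite_measure nu)
                 (cscale (-1) (charge_of_finite_measure mu)).
have chiE A : chi A = nu A - mu A.
  by rewrite /chi/= /cadd/= cscaleN1.
have [P [N hahn]] := Hahn_decomposition chi.
have [[mP Ppos] [mN Nneg] PNT PN0] := hahn.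
have finmu A : measurable A -> mu A \is a fin_num by move=> ?; exact: fin_num_measure.
have finnu A : measurable A -> nu A \is a fin_num by move=> ?; exact: fin_num_measure.
have splitPN (m : {measure set T -> \bar R}) A :
    measurable A -> m A = m (A `&` P) + m (A `&` N).
  move=> mA; rewrite -measureU//; [|exact: measurableI..|].
    by rewrite -setIUr PNT setIT.
  by rewrite setIACA PN0 setI0.
pose m := measure_add (mrestr nu mN) (mrestr mu mP).
have mE A : m A = nu (A `&` N) + mu (A `&` P) by exact: measure_addE.
pose sigma : {finite_measure set T -> \bar R} := jordan_neg hahn.
have sigmaE A : measurable A -> sigma A = mu (A `&` N) - nu (A `&` N).
  move=> mA; rewrite [LHS]jordan_negE cjordan_negE /crestr0 mem_set//.
  rewrite /crestr chiE fin_num_oppeB ?finmu ?finnu//; [|exact: measurableI..].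
  by rewrite addeC.
have mu_split A : measurable A -> mu A = m A + sigma A.
  move=> mA; rewrite sigmaE// mE (splitPN mu A)// -addeA addeCA.
  rewrite [X in _ = _ + X]addeCA subee ?adde0//.
  by apply: finnu; exact: measurableI.
have m_le A : measurable A -> m A <= nu A.
  move=> mA; rewrite mE (splitPN nu A)// [leRHS]addeC leeD2l//.
  have mAP : measurable (A `&` P) by exact: measurableI.
  by have := Ppos _ mAP (@subIsetr _ _ _); rewrite chiE sube_ge0// finmu.
have [f [mf f01 fE]] := dominated_density_le1 m_le.
have intfE : 1 - \int[nu]_x (f x)%:E = sigma setT.
  rewrite -fE// -(probability_setT mu) (mu_split _ measurableT) addeAC subee ?add0e//.
  by rewrite mE fin_numD finmu ?finnu//; exact: measurableI.
exists f, (mnormalize sigma nu); split => //.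
  move=> A mA; rewrite -fE// mu_split// intfE; congr (_ + _).
  rewrite /= /mnormalize.
  (* [mnormalize] falls back on nu when the remainder has mass 0 *)
  case: ifPn => [/orP[/eqP s0|/eqP soo]|].
  - rewrite s0 mul0e; apply/eqP; rewrite eq_le measure_ge0 andbT -s0.
    by apply: le_measure; rewrite ?inE.
  - by have := @fin_num_measure _ _ _ sigma _ measurableT; rewrite soo.
  - rewrite negb_or => /andP[s0 soo].
    have sfin : sigma setT \is a fin_num by exact: fin_num_measure.
    rewrite -[X in _ = X * _](fineK sfin) muleCA -EFinM divff ?mule1//.
    by rewrite fine_eq0.
exists P => //; rewrite intfE sigmaE// setTI.
have h : mu P + mu N = nu P + nu N.
  have := splitPN mu _ measurableT; have := splitPN nu _ measurableT.
  by rewrite !setTI => <- <-; exact: etrans (probability_setT mu) (esym (probability_setT nu)).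
move: h; rewrite -(fineK (finmu _ mP)) -(fineK (finmu _ mN)).
rewrite -(fineK (finnu _ mP)) -(fineK (finnu _ mN)) -!EFinD => -[h].
by congr EFin; lra.
Qed.

End overlap_of_measures.

(** * Replacing the law of a random variable *)

Section replacing_the_law.
Local Open Scope ereal_scope.
Context {R : realType}.

Local Notation unif := (uniform_prob (@ltr01 R)).

Lemma uniform_prob_le (p : R) : (0 <= p <= 1)%R ->
  unif [set u | (u <= p)%R] = p%:E.
Proof.
move=> /andP[p0 p1].
rewrite /uniform_prob integral_uniform_pdf.
rewrite (_ : _ `&` _ = `[0%R, p]%classic); last first.
  apply/seteqP; split => x /=; rewrite !in_itv/=.
    by move=> [-> /andP[-> _]].
  by move=> /andP[-> xp]; split => //; rewrite (le_trans xp).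
rewrite (eq_integral (cst 1)); last first.
  move=> x; rewrite inE/= in_itv/= => /andP[x0 xp].
  by rewrite /uniform_pdf x0 (le_trans xp)//= subr0 invr1.
rewrite integral_cst//= mul1e lebesgue_measure_itv/= lte_fin.
by case: ltP => [|p0']; rewrite ?oppr0 ?adde0//; congr EFin; lra.
Qed.

Lemma measurable_subgraph {d} {T : measurableType d} (g : T -> R) :
  measurable_fun setT g -> measurable [set p : T * measurableTypeR R | (p.2 <= g p.1)%R].
Proof.
move=> mg; rewrite -[X in measurable X]setTI.
apply: (@measurable_fun_ler _ _ _ setT snd (g \o fst)) => //.
by apply: measurableT_comp.
Qed.

Lemma product_uniform_subgraph {d} {T : measurableType d}
    (Pr : probability T R) (g : T -> R) (B : set T) :
  measurable_fun setT g -> (forall x, (0 <= g x <= 1)%R) -> measurable B ->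
  (Pr \x unif) ([set p | (p.2 <= g p.1)%R] `&` (B `*` setT)) =
  \int[Pr]_(x in B) (g x)%:E.
Proof.
move=> mg g01 mB; rewrite /product_measure1 [RHS]integral_mkcond.
apply: eq_integral => x _ /=; rewrite /patch.
case: ifPn => xB.
  rewrite -uniform_prob_le//; congr (unif _).
  apply/seteqP; split => u; rewrite /xsection/= inE/=; first by case.
  by move=> ?; split => //; split => //; exact: set_mem.
transitivity (unif set0); last exact: measure0.
congr (unif _); apply/seteqP; split => // u.
by rewrite /xsection/= inE/= => -[_ [/mem_set]]; rewrite (negbTE xB).
Qed.

(** With u uniform on [0, 1], keep Z when u <= f(Z) and otherwise take an
independent sample from rho, f and rho being given by [overlap_decomposition]:
restricted to the first event, Z has law f nu, where nu is the law of Z, and the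
second event, independent of the sample, has probability 1 - int f dnu. The map
back to the original sample space transports every random variable defined there
to the new one without changing its joint law with Z. *)
Lemma replace_law {d d'} {T : measurableType d} {Omega : measurableType d'}
    (Pr : probability Omega R) (Z : {mfun Omega >-> T}) (mu : probability T R) :
  exists (d1 : measure_display) (Omega1 : measurableType d1)
      (Q : probability Omega1 R) (back : {mfun Omega1 >-> Omega})
      (X : {mfun Omega1 >-> T}) (G : set Omega1),
    [/\ forall A, measurable A -> Q (back @^-1` A) = Pr A,
        forall A, measurable A -> Q (X @^-1` A) = mu A,
        measurable G, forall v, ~ G v -> X v = Z (back v) &
        exists2 S, measurable S & Q G = distribution Pr Z S - mu S].
Proof.
have [f [rho [mf f01 muE SE]]] := overlap_decomposition mu (distribution Pr Z).
pose g w := f (Z w).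
have mg : measurable_fun setT g by exact: measurableT_comp.
have g01 w : (0 <= g w <= 1)%R by exact: f01.
pose H := [set p : Omega * measurableTypeR R | (p.2 <= g p.1)%R].
have mH : measurable H by exact: measurable_subgraph.
pose PU : probability (Omega * measurableTypeR R)%type R := Pr \x unif.
pose Q : probability (Omega * measurableTypeR R * T)%type R := PU \x rho.
have PUH B : measurable B ->
    PU (H `&` ((Z @^-1` B) `*` setT)) = \int[distribution Pr Z]_(x in B) (f x)%:E.
  move=> mB.
  have mZB : measurable (Z @^-1` B) by rewrite -[X in measurable X]setTI; exact: measurable_funP.
  rewrite [LHS]product_uniform_subgraph//.
  rewrite ge0_integral_pushforward//.
  - exact/measurable_EFinP/measurable_funTS.
  - by move=> x _; rewrite lee_fin; case/andP: (f01 x).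
have PUHC : PU (~` H) = 1 - \int[distribution Pr Z]_x (f x)%:E.
  have := PUH setT measurableT; rewrite preimage_setT setXTT setIT => <-.
  exact: probability_setC.
pose X (v : Omega * measurableTypeR R * T) := if (v.1.2 <= g v.1.1)%R then Z v.1.1 else v.2.
have mX : measurable_fun setT X.
  apply: measurable_fun_ifT.
  - apply: measurable_fun_ler.
    + exact: measurableT_comp.
    + by apply: measurableT_comp => //; exact: measurableT_comp.
  - by apply: measurableT_comp => //; exact: measurableT_comp.
  - exact: measurable_snd.
have mback : measurable_fun setT (fun v : Omega * measurableTypeR R * T => v.1.1).
  exact: measurableT_comp.
pose X' : {mfun (Omega * measurableTypeR R * T)%type >-> T} := mfun_Sub (mem_set mX).
pose back : {mfun (Omega * measurableTypeR R * T)%type >-> Omega} := mfun_Sub (mem_set mback).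
have QX A B : measurable A -> measurable B -> Q (A `*` B) = PU A * rho B.
  by move=> mA mB; exact: product_measure1E.
exists _, _, Q, back, X', ((~` H) `*` setT); split.
- move=> A mA.
  rewrite (_ : _ @^-1` _ = (A `*` setT) `*` setT); last first.
    by apply/seteqP; split => -[[w u] a] //= => -[[]].
  rewrite QX//; last exact: measurableX.
  rewrite [X in _ * X]probability_setT mule1 [LHS]product_measure1E//.
  by rewrite [X in _ * X]probability_setT mule1.
- move=> A mA.
  have mZA : measurable (Z @^-1` A) by rewrite -[X in measurable X]setTI; exact: measurable_funP.
  have mHA : measurable (H `&` ((Z @^-1` A) `*` setT)).
    by apply: measurableI => //; exact: measurableX.
  rewrite (_ : _ @^-1` _ = (H `&` ((Z @^-1` A) `*` setT)) `*` setT `|` (~` H) `*` A); last first.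
    apply/seteqP; split => -[[w u] a]; rewrite /preimage/= /X/= /H/=.
      by case: ifPn => h; [left|right]; split => //; exact/negP.
    by case: ifPn => h [[[? [? ?]] _]|[? ?]].
  transitivity (Q ((H `&` ((Z @^-1` A) `*` setT)) `*` setT) + Q ((~` H) `*` A)).
    apply: measureU; first exact: measurableX.
      by apply: measurableX => //; exact: measurableC.
    by apply/seteqP; split => // -[? ?] [[[? _] _] []].
  rewrite !QX//; last exact: measurableC.
  by rewrite PUHC PUH// [X in _ * X + _]probability_setT mule1 -muE.
- by apply: measurableX => //; exact: measurableC.
- move=> [[w u] a] /= h; rewrite /X/=; case: ifPn => // uw.
  by exfalso; apply: h; split => //; exact/negP.
- have [S mS SE'] := SE; exists S => //.
  rewrite QX//; last exact: measurableC.
  by rewrite [X in _ * X]probability_setT mule1 PUHC.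
Qed.

End replacing_the_law.

(** * Measurability of the distance *)

Lemma countable_bigcup_measurable {d} {T : measurableType d} {U : Type}
    (D : set U) (F : U -> set T) :
  countable D -> (forall u, measurable (F u)) -> measurable (\bigcup_(u in D) F u).
Proof.
move=> cD mF; have [->|/set0P[r Dr]] := eqVneq D set0; first by rewrite bigcup_set0.
have /countable_injP[f injf] := cD.
rewrite -(injpinv_image (cst r) injf) bigcup_image.
by apply: bigcup_measurable.
Qed.

Section polish_measurability.
Context {R : realType} {d : measure_display} {E : polishSpaceType d R}.

Lemma borel_open (U : set E) : open U -> measurable U.
Proof. by move=> oU; rewrite polish_borel; exact: sub_sigma_algebra. Qed.

Lemma continuous_borel (phi : E -> R) :
  continuous phi -> measurable_fun setT phi.
Proof.
move=> /continuousP cphi.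
apply: (measurability _ (RGenOInfty.measurableE R)) => _ [_ [r ->] <-].
by rewrite setTI; apply: borel_open; apply: cphi; exact: rray_open.
Qed.

Lemma nearby_mdist (x : E) (e : R) : 0 < e -> \forall y \near x, mdist x y < e.
Proof.
by move=> e0; have := nbhsx_ballx x e e0; rewrite ballEmdist.
Qed.

Lemma mdist_lipschitz (q x y : E) : `|mdist q x - mdist q y| <= mdist x y.
Proof.
have := metric_triangle q x y; have := metric_triangle q y x.
by rewrite (metric_sym y x) ler_norml => ? ?; apply/andP; split; lra.
Qed.

Lemma lipschitz_continuous (K : R) (phi : E -> R) :
  0 < K -> lipschitz_with K phi -> continuous phi.
Proof.
move=> K0 lphi x; apply/cvgrPdist_lt => e e0.
near=> y; apply: (le_lt_trans (lphi x y)).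
rewrite mulrC -ltr_pdivlMr//; near: y; apply: nearby_mdist.
exact: divr_gt0.
Unshelve. all: by end_near. Qed.

(** The product sigma-algebra is generated by rectangles, so continuity of the
distance does not suffice: separability writes d(x,y) as the supremum over a
countable dense set of |d(q,x) - d(q,y)|. *)
Lemma measurable_mdist : measurable_fun setT (fun p : E * E => mdist p.1 p.2).
Proof.
have [D cD dD] := @polish_separable d R E.
have mq q : measurable_fun setT (@mdist R E q).
  apply/continuous_borel/(@lipschitz_continuous 1) => // x y.
  by rewrite mul1r mdist_lipschitz.
apply: (measurability _ (RGenOInfty.measurableE R)) => _ [_ [r ->] <-].
rewrite setTI (_ : _ @^-1` _ = \bigcup_(q in D)
    [set p : E * E | r < `|mdist q p.1 - mdist q p.2|]); last first.
  apply/seteqP; split => [[x y]|[x y] [q _]] /=; rewrite in_itv/= andbT; last first.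
    by move=> /lt_le_trans; apply; exact: mdist_lipschitz.
  move=> rxy; pose e := (mdist x y - r) / 2.
  have e0 : 0 < e by rewrite divr_gt0// subr_gt0.
  have [oB Bx] := open_nbhs_ball x (PosNum e0).
  have [q [/interior_subset xq Dq]] := dD _ (ex_intro _ x Bx) oB.
  exists q => //=; move: xq; rewrite ballEmdist/= => xq.
  rewrite ltr_normr; apply/orP; right.
  by have := metric_triangle x q y; rewrite (metric_sym q x) /e in xq *; lra.
apply: countable_bigcup_measurable => // q.
rewrite -[X in measurable X]setTI; apply: measurable_fun_ltr => //.
by apply: measurableT_comp => //; apply: measurable_funB; exact: measurableT_comp.
Qed.

End polish_measurability.

(** * Couplings with small truncated distance *)

Section coupling.
Local Open Scope ereal_scope.
Context {R : realType} {d : measure_display} {E : polishSpaceType d R}.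

Definition truncated_distance (a b : R) (x y : E) : R :=
  Num.min a (b * mdist x y)%R.

Lemma truncated_distance_ge0 (a b : R) (x y : E) :
  (0 <= a)%R -> (0 <= b)%R -> (0 <= truncated_distance a b x y)%R.
Proof. by move=> a0 b0; rewrite le_min a0 mulr_ge0// mdist_ge0. Qed.

Lemma measurable_truncated_distance (a b : R) :
  measurable_fun setT (fun p : E * E => truncated_distance a b p.1 p.2).
Proof.
apply: measurable_minr => //; apply: measurable_funM => //.
exact: measurable_mdist.
Qed.

Lemma measurable_mdist_comp {d'} {T : measurableType d'} (X Y : {mfun T >-> E}) :
  measurable_fun setT (fun w => mdist (X w) (Y w)).
Proof.
apply: (measurableT_comp measurable_mdist (g := fun w => (X w, Y w))).
exact: measurable_fun_pair.
Qed.

(** The cost is truncated because the replaced value X may be arbitrarily far from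
Y on the exceptional event G, where only the bound a is available. One coupling
serves all truncation levels at once. *)
Lemma coupling_of_near_copies {d'} {Omega : measurableType d'}
    (Pr : probability Omega R) (Y Z : {RV Pr >-> E})
    (mu nu : {measure set E -> \bar R}) (v w : R) :
  mu setT = 1 ->
  (forall A, measurable A -> distribution Pr Y A = nu A) ->
  total_variation_distance (distribution Pr Z) mu <= v%:E ->
  'E_Pr[fun o => mdist (Z o) (Y o)] <= w%:E ->
  exists2 gamma, couplings mu nu gamma & forall a b : R, (0 <= a)%R -> (0 <= b)%R ->
    \int[gamma]_p (truncated_distance a b p.1 p.2)%:E <= (a * v + b * w)%:E.
Proof.
move=> mu1 Ynu tv ed.
(* normalizing does not change mu, it only records that mu is a probability *)
pose mu' : probability E R := mnormalize mu (distribution Pr Z).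
have mu'E A : mu' A = mu A.
  by rewrite /mu'/= /mnormalize/= mu1 onee_eq0/= invr1 mule1.
have [d1 [W1 [Q [back [X [G [Qback QX mG XZ [S mS QG]]]]]]]] := replace_law Pr Z mu'.
have QGv : Q G <= v%:E.
  rewrite QG (le_trans _ tv)//.
  rewrite (le_trans (lee_abs _))//; apply: ereal_sup_ubound; exists S => //.
  by rewrite -mu'E.
pose D o := mdist (Z o) (Y o).
have mD : measurable_fun setT D by exact: measurable_mdist_comp.
have D0 o : 0 <= (D o)%:E by rewrite lee_fin mdist_ge0.
have EDback : \int[Q]_o (D (back o))%:E = 'E_Pr[D].
  rewrite unlock; transitivity (\int[pushforward Q back]_o (D o)%:E).
    by rewrite ge0_integral_pushforward//; exact/measurable_EFinP.
  by apply: eq_measure_integral => A mA _; exact: Qback.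
have mXY : measurable_fun setT (fun o => (X o, Y (back o))).
  by apply: measurable_fun_pair => //; exact: measurableT_comp.
pose XY : {mfun W1 >-> (E * E)%type} := mfun_Sub (mem_set mXY).
exists (distribution Q XY).
  move=> A mA; split.
    rewrite -mu'E -QX//= /distribution/pushforward; congr (Q _).
    by apply/seteqP; split => o //= -[].
  transitivity (distribution Pr Y A); last exact: Ynu.
  rewrite /distribution/pushforward -Qback; last first.
    by rewrite -[X in measurable X]setTI; exact: measurable_funP.
  by congr (Q _); apply/seteqP; split => o /=; [case|].
move=> a b a0 b0.
rewrite ge0_integral_pushforward//; last 2 first.
- by apply/measurable_EFinP; exact: measurable_truncated_distance.
- by move=> p _; rewrite lee_fin truncated_distance_ge0.
rewrite preimage_setT.
apply: (@le_trans _ _ (\int[Q]_o (a%:E * (\1_G o)%:E + b%:E * (D (back o))%:E))).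
  apply: ge0_le_integral => //=.
  - by move=> o _; rewrite lee_fin truncated_distance_ge0.
  - apply/measurable_EFinP.
    by apply: (measurableT_comp (measurable_truncated_distance a b) (g := XY)).
  - apply/measurable_EFinP; apply: measurable_funD.
      by apply: measurable_funM.
    by apply: measurable_funM => //; exact: measurableT_comp.
  - move=> o _; rewrite -!EFinM -EFinD lee_fin indicE.
    rewrite /truncated_distance; case: (boolP (o \in G)) => oG.
      rewrite mulr1 ge_min; apply/orP; left.
      by rewrite lerDl mulr_ge0// mdist_ge0.
    rewrite mulr0 add0r XZ; last by move/mem_set; exact/negP.
    by rewrite ge_min lexx orbT.
rewrite ge0_integralD//; last 4 first.
- by move=> o _; rewrite -EFinM lee_fin mulr_ge0.
- by apply: measurable_funeM; exact/measurable_EFinP.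
- by move=> o _; rewrite -EFinM lee_fin mulr_ge0// mdist_ge0.
- apply: measurable_funeM; apply/measurable_EFinP; exact: measurableT_comp.
rewrite !ge0_integralZl_EFin//; last 2 first.
- exact/measurable_EFinP/measurableT_comp.
- exact/measurable_EFinP.
rewrite integral_indic// setIT EDback EFinD !EFinM.
by apply: leeD; apply: lee_wpmul2l; rewrite ?lee_fin.
Qed.

End coupling.

(** * Truncated distances as pseudo-metrics *)

Section truncated_pseudo_metrics.
Context {R : realType} {d : measure_display} {E : polishSpaceType d R}.

Lemma truncated_pseudo_metric (c : R) :
  0 <= c -> pseudo_metric (truncated_distance 1 c : E -> E -> R).
Proof.
move=> c0; rewrite /truncated_distance; split => [x y|x|x y|x y z].
- exact: truncated_distance_ge0.
- by rewrite mdistxx mulr0 min_r.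
- by rewrite metric_sym.
- have [xy1|/ltW xy1] := leP 1 (c * mdist x y).
    by rewrite ge_min lerDl; apply/orP; left; exact: truncated_distance_ge0.
  have [yz1|/ltW yz1] := leP 1 (c * mdist y z).
    by rewrite ge_min lerDr mulr_ge0// mdist_ge0.
  by rewrite -mulrDr ge_min ler_wpM2l ?orbT// metric_triangle.
Qed.

Lemma truncated_continuous (c : R) : 0 < c ->
  continuous (fun p : E * E => truncated_distance 1 c p.1 p.2).
Proof.
move=> c0 [x y]; apply/cvgrPdist_lt => e e0 /=.
have ec0 : 0 < e / (2 * c) by rewrite divr_gt0// mulr_gt0.
exists ([set x' | mdist x x' < e / (2 * c)], [set y' | mdist y y' < e / (2 * c)]).
  by split; exact: nearby_mdist.
move=> [x' y'] [/= xx' yy'].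
have cxx' : c * mdist x x' < e / 2.
  by move: xx'; rewrite invfM mulrA ltr_pdivlMr// mulrC.
have cyy' : c * mdist y y' < e / 2.
  by move: yy'; rewrite invfM mulrA ltr_pdivlMr// mulrC.
have h1 : c * mdist x y <= c * mdist x x' + c * mdist x' y' + c * mdist y y'.
  rewrite -!mulrDr ler_wpM2l// ?(ltW c0)//.
  have := metric_triangle x x' y; have := metric_triangle x' y' y.
  by rewrite (metric_sym y' y); lra.
have h2 : c * mdist x' y' <= c * mdist x x' + c * mdist x y + c * mdist y y'.
  rewrite -!mulrDr ler_wpM2l// ?(ltW c0)//.
  have := metric_triangle x' x y'; have := metric_triangle x y y'.
  by rewrite (metric_sym x' x); lra.
rewrite /truncated_distance ltr_norml.
by case: (leP 1 (c * mdist x y)) => ?; case: (leP 1 (c * mdist x' y')) => ?;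
  apply/andP; split; lra.
Qed.

End truncated_pseudo_metrics.

(** * From couplings to transition operators *)

Section consequences.
Context {R : realType} {d : measure_display} {E : polishSpaceType d R}.

Lemma bounded_fun_ubound {T : Type} (phi : T -> R) : bounded_fun phi ->
  exists2 M : R, 0 < M & forall x, `|phi x| <= M.
Proof.
by move=> /pinfty_ex_gt0[M M0 phiM]; exists M => // x; exact: (phiM x Logic.I).
Qed.

Lemma le_sup_norm (phi : E -> R) x : bounded_fun phi -> `|phi x| <= sup_norm phi.
Proof.
move=> /bounded_fun_ubound[M M0 phiM]; apply: ub_le_sup; last by exists x.
by exists M => _ [y _ <-].
Qed.

Lemma Rintegral_law {d1 d2} {T1 : measurableType d1} {T2 : measurableType d2}
    (mu : probability T1 R) (nu : {measure set T2 -> \bar R}) (f : T1 -> T2)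
    (phi : T2 -> R) :
  measurable_fun setT f -> measurable_fun setT phi -> bounded_fun phi ->
  (forall A, measurable A -> mu (f @^-1` A) = nu A) ->
  mu.-integrable setT (EFin \o (phi \o f)) /\
  \int[nu]_x phi x = \int[mu]_w phi (f w).
Proof.
move=> mf mphi bphi fnu.
have ifphi : mu.-integrable setT (EFin \o (phi \o f)).
  apply: measurable_bounded_integrable => //.
  - by rewrite -ge0_fin_numE//; exact: fin_num_measure.
  - exact: measurableT_comp.
  - by have [M [Mr phiM]] := bphi; exists M; split => // N MN w _; exact: phiM.
split=> //; rewrite /Rintegral; congr fine.
pose f' : {mfun T1 >-> T2} := mfun_Sub (mem_set mf).
transitivity (\int[pushforward mu f']_x (phi x)%:E)%E.
  by apply: eq_measure_integral => A mA _; rewrite -fnu.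
rewrite (integral_pushforward mf) ?preimage_setT//.
exact/measurable_EFinP.
Qed.

Lemma coupling_Rintegral_dist (mu nu : {measure set E -> \bar R}) gamma
    (phi : E -> R) :
  couplings mu nu gamma -> measurable_fun setT phi -> bounded_fun phi ->
  (`|\int[mu]_x phi x - \int[nu]_x phi x|%:E <=
    \int[gamma]_p (`|phi p.1 - phi p.2|)%:E)%E.
Proof.
move=> cpl mphi bphi.
have law1 A : measurable A -> gamma (fst @^-1` A) = mu A.
  move=> mA; rewrite -(cpl A mA).1; congr (gamma _).
  by apply/seteqP; split => -[x y] //= -[].
have law2 A : measurable A -> gamma (snd @^-1` A) = nu A.
  move=> mA; rewrite -(cpl A mA).2; congr (gamma _).
  by apply/seteqP; split => -[x y] //= -[].
have [i1 ->] := Rintegral_law measurable_fst mphi bphi law1.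
have [i2 ->] := Rintegral_law measurable_snd mphi bphi law2.
rewrite -RintegralB//.
rewrite EFin_normr_Rintegral//; last first.
  exact: (integrableB measurableT i1 i2).
apply: (le_trans (le_abse_integral _ _ _)) => //.
by apply/measurable_EFinP; apply: measurable_funB; exact: measurableT_comp.
Qed.

(** The form in which the hypothesis is used from here on: genuine couplings of
P_t(x,.) and P_t(y,.), with the estimate of [coupling_of_near_copies]. *)
Definition coupled_at_rate (P : R -> R.-pker E ~> E) (F1 F2 r : R -> R) (x0 : E) :=
  forall (x y : E) (t : R), 0 <= t ->
  exists2 gamma, couplings (P t x) (P t y) gamma &
    forall a b : R, 0 <= a -> 0 <= b ->
    (\int[gamma]_p (truncated_distance a b p.1 p.2)%:E <=
      ((a * F1 (Num.max (mdist x x0) (mdist y x0)) +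
        b * (F2 (Num.max (mdist x x0) (mdist y x0)) * r t)) * mdist x y)%:E)%E.

Section from_couplings.
Variables (P : R -> R.-pker E ~> E) (F1 F2 r : R -> R) (x0 : E).
Hypotheses (F1nd : nonneg_nondecreasing F1) (F2nd : nonneg_nondecreasing F2)
  (rni : nonneg_nonincreasing r) (cplP : coupled_at_rate P F1 F2 r x0).

Lemma max_mdist_ge0 (x y : E) : 0 <= Num.max (mdist x x0) (mdist y x0).
Proof. by rewrite le_max mdist_ge0. Qed.

Lemma semigroup_op_lipschitz (t delta K : R) (phi : E -> R) (x y : E) :
  0 <= t -> r t <= delta -> 0 < K -> lipschitz_with K phi -> bounded_fun phi ->
  `|semigroup_op P t phi x - semigroup_op P t phi y| <=
    mdist x y * (2 * F1 (Num.max (mdist x x0) (mdist y x0)) +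
                 F2 (Num.max (mdist x x0) (mdist y x0))) *
      (sup_norm phi + delta * K).
Proof.
move=> t0 rdelta K0 lphi bphi.
have [gamma cpl] := cplP x y t0.
have m0 := max_mdist_ge0 x y; set m := Num.max _ _ in m0 * => gammaE.
have mphi : measurable_fun setT phi.
  by apply/continuous_borel/lipschitz_continuous; eassumption.
have s0 : 0 <= sup_norm phi by rewrite (le_trans _ (le_sup_norm x bphi)).
rewrite -lee_fin (le_trans (coupling_Rintegral_dist cpl mphi bphi))//.
apply: (@le_trans _ _
    (\int[gamma]_p (truncated_distance (2 * sup_norm phi) K p.1 p.2)%:E)%E).
  apply: ge0_le_integral => //=.
  - apply/measurable_EFinP/measurableT_comp => //.
    by apply: measurable_funB; exact: measurableT_comp.
  - by apply/measurable_EFinP; exact: measurable_truncated_distance.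
  - move=> p _; rewrite lee_fin le_min lphi andbT (le_trans (ler_normB _ _))//.
    by rewrite mulr_natl mulr2n lerD// le_sup_norm.
rewrite (le_trans (gammaE _ _ _ (ltW K0)))//; first by rewrite mulr_ge0.
have f1 := F1nd.1 m m0; have f2 := F2nd.1 m m0; have rt0 := rni.1 t t0.
have delta0 : 0 <= delta by exact: le_trans rdelta.
rewrite lee_fin -[leRHS]mulrA [leRHS]mulrC ler_wpM2r ?mdist_ge0//.
have h1 : 0 <= F1 m * (delta * K) by rewrite !mulr_ge0// ltW.
have h2 : 0 <= F2 m * sup_norm phi by rewrite mulr_ge0.
have h3 : K * (F2 m * r t) <= F2 m * (delta * K).
  by rewrite mulrC -mulrA ler_wpM2l// ler_wpM2r// ltW.
lra.
Qed.

(** * The Feller property *)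

(** Local Lipschitz continuity is at hand only for Lipschitz phi. For continuous
phi the first point of the coupling is kept away from the open set where phi
oscillates at scale 1/(k+1): the mass of this set is taken under P_t(x,.), so k
can be chosen before y. *)
Lemma coupled_feller : feller P.
Proof.
move=> t t0 phi bphi cphi x; apply/cvgrPdist_le => e e0.
have [M M0 phiM] := bounded_fun_ubound bphi.
have mphi : measurable_fun setT phi by exact: continuous_borel.
pose Bad k := [set z | exists w, mdist z w < k.+1%:R^-1 /\ e / 3 < `|phi z - phi w|].
have oBad k : open (Bad k).
  rewrite openE => z [w [zw phizw]]; rewrite /interior.
  have h1 : 0 < k.+1%:R^-1 - mdist z w by rewrite subr_gt0.
  have h2 : 0 < `|phi z - phi w| - e / 3 by rewrite subr_gt0.
  have phicz := cphi z; move/cvgrPdist_lt : phicz => /(_ _ h2) phicz.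
  near=> z'; exists w; split.
    have zz' : mdist z z' < k.+1%:R^-1 - mdist z w by near: z'; exact: nearby_mdist.
    have := metric_triangle z' z w; rewrite (metric_sym z' z).
    by move: zz'; set c := _^-1; lra.
  have : `|phi z - phi z'| < `|phi z - phi w| - e / 3 by near: z'.
  by have := ler_distD (phi z') (phi z) (phi w); lra.
have mBad k : measurable (Bad k) by exact: borel_open.
have capBad : \bigcap_k Bad k = set0.
  apply/seteqP; split => // z Badz.
  have phicz := cphi z; move/cvgrPdist_lt : phicz => /(_ _ (divr_gt0 e0 (ltr0n _ 3))).
  rewrite -(@metricType_numDomainType.filter_from_mdist_nbhs _ _ z).
  move=> [eta /= eta0 phieta].
  have [k keta] := ltr_add_invr eta0; rewrite add0r in keta.
  have [w [zw]] := Badz k Logic.I.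
  by rewrite ltNge => /negP; apply; apply/ltW/phieta/(lt_trans zw).
have PBad0 : (P t x (Bad k) @[k --> \oo] --> 0)%E.
  rewrite -(measure0 (P t x)) -capBad; apply: nonincreasing_cvg_mu => //.
  - rewrite (le_lt_trans (le_measure _ _ _ (@subsetT _ _))) ?inE//.
    by rewrite [X in (X < _)%E](_ : _ = 1%E) ?ltry//; exact: prob_kernel.
  - by rewrite capBad.
  - move=> k l kl; apply/subsetPset => z [w [zw phizw]]; exists w; split => //.
    by rewrite (lt_le_trans zw)// lef_pV2 ?posrE// ler_nat.
(* 6 M is 3 times the factor 2 M that multiplies P_t(x,Bad k) below *)
have [k Pk] : exists k, (P t x (Bad k) <= (e / (6 * M))%:E)%E.
  have eM0 : (0 < (e / (6 * M))%:E)%E by rewrite lte_fin divr_gt0// mulr_gt0.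
  have : nbhs 0%E [set u | (u < (e / (6 * M))%:E)%E].
    by apply: open_nbhs_nbhs; split => //; exact: open_ereal_lt_ereal.
  by move=> /PBad0[k _ Bk]; exists k; apply/ltW/Bk => /=.
(* for y within distance 1 of x, monotonicity bounds F1 and F2 at rho *)
pose rho := mdist x x0 + 1.
have rho0 : 0 <= rho by rewrite addr_ge0// mdist_ge0.
pose C := 2 * M * F1 rho + 2 * M * k.+1%:R * (F2 rho * r t).
have C0 : 0 <= C.
  by rewrite addr_ge0// !mulr_ge0 ?(ltW M0)// ?(F1nd.1,F2nd.1,rni.1).
near=> y.
have xy1 : mdist x y < 1 by near: y; exact: nearby_mdist.
have xyC : mdist x y < e / 3 / (C + 1).
  by near: y; apply: nearby_mdist; rewrite !divr_gt0// ltr_wpDl.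
have [gamma cpl gammaE] := cplP x y t0.
move: gammaE; set m := Num.max _ _ => gammaE.
have m0 : 0 <= m by exact: max_mdist_ge0.
have mrho : m <= rho.
  rewrite ge_max; apply/andP; split; rewrite /rho; first by rewrite lerDl.
  by have := metric_triangle y x x0; rewrite (metric_sym y x); lra.
rewrite -lee_fin (le_trans (coupling_Rintegral_dist cpl mphi bphi))//.
pose T := fun p : E * E => truncated_distance (2 * M) (2 * M * k.+1%:R) p.1 p.2.
have mT : measurable_fun setT T by exact: measurable_truncated_distance.
have M20 : 0 <= 2 * M by rewrite mulr_ge0// ltW.
have T0 p : 0 <= T p by apply: truncated_distance_ge0; rewrite // mulr_ge0.
have mBadT : measurable (Bad k `*` [set: E]) by exact: measurableX.
pose B (p : E * E) : R := 2 * M * \1_(Bad k `*` [set: E]) p.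
have mB : measurable_fun setT B by exact: measurable_funM.
have B0 p : 0 <= B p by rewrite mulr_ge0.
apply: (@le_trans _ _ (\int[gamma]_p ((e / 3)%:E + ((B p)%:E + (T p)%:E)))%E).
  apply: ge0_le_integral => //=.
  - apply/measurable_EFinP/measurableT_comp => //.
    by apply: measurable_funB; exact: measurableT_comp.
  - apply/measurable_EFinP; apply: measurable_funD => //; exact: measurable_funD.
  - move=> p _; rewrite -!EFinD lee_fin /B.
    have phi2M : `|phi p.1 - phi p.2| <= 2 * M.
      by rewrite (le_trans (ler_normB _ _))// mulr_natl mulr2n lerD.
    have [pBad|pBad] := pselect (Bad k p.1).
      rewrite indicE mem_set//= mulr1 (le_trans phi2M)// addrCA lerDl.
      by rewrite addr_ge0// divr_ge0// ltW.
    rewrite indicE memNset//=; last by case.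
    rewrite mulr0 add0r.
    have [far|near] := leP k.+1%:R^-1 (mdist p.1 p.2).
      rewrite /T /truncated_distance min_l; first by rewrite ler_wpDl// divr_ge0// ltW.
      by rewrite -mulrA ler_peMr// mulrC -ler_pdivrMr// mul1r.
    rewrite ler_wpDr//.
    by rewrite leNgt; apply/negP => h; apply: pBad; exists p.2.
rewrite ge0_integralD//=; last 3 first.
- by move=> p _; rewrite lee_fin divr_ge0// ltW.
- by move=> p _; rewrite -EFinD lee_fin addr_ge0.
- by apply/measurable_EFinP; exact: measurable_funD.
rewrite ge0_integralD//=; last 4 first.
- by move=> p _; rewrite lee_fin.
- exact/measurable_EFinP.
- by move=> p _; rewrite lee_fin.
- exact/measurable_EFinP.
rewrite integral_cst// [X in (_ * X)%E](_ : _ = 1%E); last exact: probability_setT.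
have intB : (\int[gamma]_p (B p)%:E <= (e / 3)%:E)%E.
  rewrite (eq_integral (fun p => (2 * M)%:E * (\1_(Bad k `*` [set: E]) p)%:E)%E)//.
  rewrite ge0_integralZl_EFin//; last exact/measurable_EFinP.
  rewrite integral_indic// setIT.
  rewrite [X in (_ * X)%E](_ : _ = P t x (Bad k)); last exact: (cpl _ (mBad k)).1.
  apply: (@le_trans _ _ ((2 * M)%:E * (e / (6 * M))%:E)%E).
    by apply: lee_wpmul2l; rewrite ?lee_fin.
  by rewrite -EFinM lee_fin le_eqVlt; apply/orP; left; apply/eqP; field; rewrite gt_eqF.
have intT : (\int[gamma]_p (T p)%:E <= (e / 3)%:E)%E.
  rewrite (le_trans (gammaE _ _ _ _))//; first by rewrite mulr_ge0.
  rewrite lee_fin; apply: (@le_trans _ _ (C * mdist x y)).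
    rewrite ler_wpM2r ?mdist_ge0// lerD//.
      by rewrite ler_wpM2l//; exact: F1nd.2.
    rewrite ler_wpM2l//; first by rewrite mulr_ge0.
    rewrite ler_wpM2r ?rni.1//; exact: F2nd.2.
  have := xyC; rewrite ltr_pdivlMr ?ltr_wpDl// => /ltW; apply: le_trans.
  by rewrite mulrC ler_wpM2l ?mdist_ge0// lerDl.
rewrite mule1 (le_trans (leeD2l _ (leeD intB intT)))// -!EFinD lee_fin.
lra.
Unshelve. all: by end_near. Qed.

(** * The two asymptotic strong Feller properties *)

Hypothesis r0 : r t @[t --> +oo] --> (0 : R).

(** The inverse of n + 1 is added since r may vanish, whereas ASF+ asks for positive
delta_n and the distances below divide by this quantity. *)
Definition rate (n : nat) : R := r n%:R + n.+1%:R^-1.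

Lemma rate_gt0 n : 0 < rate n.
Proof. by rewrite ltr_wpDl ?invr_gt0// rni.1. Qed.

Lemma rate_nonincreasing : nonincreasing_seq rate.
Proof.
move=> n m nm; rewrite lerD//; first by apply: rni.2; rewrite ?ler_nat.
by rewrite lef_pV2 ?posrE// ler_nat.
Qed.

Lemma rate_cvg0 : rate n @[n --> \oo] --> (0 : R).
Proof.
rewrite -[X in _ --> X]addr0; apply: cvgD; last exact: cvg_harmonic.
exact: (cvg_comp _ _ cvgr_idn r0).
Qed.

Lemma coupled_asf_plus : asf_plus_with P (fun u => 2 * F1 u + F2 u).
Proof.
split; last split.
- split=> [u u0|u v u0 uv].
    by rewrite addr_ge0// ?mulr_ge0// ?F1nd.1 ?F2nd.1.
  by rewrite lerD// ?ler_wpM2l// ?F1nd.2 ?F2nd.2.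
- exact: coupled_feller.
exists x0, (fun n => n%:R), rate; split.
- by split=> // n m nm; rewrite ler_nat.
- by split; [exact: rate_gt0|exact: rate_nonincreasing].
- exact: rate_cvg0.
move=> phi K K0 lphi bphi n _ x y.
apply: semigroup_op_lipschitz => //.
by rewrite /rate lerDl invr_ge0.
Qed.

Definition rescaled_distance (n : nat) : E -> E -> R :=
  truncated_distance 1 (rate n.+1)^-1.

Lemma rescaled_totally_separating : totally_separating rescaled_distance.
Proof.
split.
- by move=> n; apply: truncated_pseudo_metric; rewrite invr_ge0 ltW// rate_gt0.
- move=> n; exists 1; split => // M M1 p _ /=.
  rewrite ger0_norm; last by apply: truncated_distance_ge0; rewrite ?invr_ge0 ?ltW ?rate_gt0.
  by rewrite (le_trans _ (ltW M1))// ge_min lexx.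
- by move=> n; apply: truncated_continuous; rewrite invr_gt0 rate_gt0.
- move=> x y n m nm; rewrite le_min ge_min lexx/=.
  rewrite ge_min; apply/orP; right.
  rewrite ler_wpM2r ?mdist_ge0// lef_pV2 ?posrE ?rate_gt0//.
  exact: rate_nonincreasing.
- move=> x y; rewrite -mdist_gt0 => xy0.
  (* the truncation is reached as soon as the rate is below d(x,y) *)
  have /cvgrPdist_lt /(_ _ xy0) [N _ rateN] := rate_cvg0.
  apply: cvg_near_cst; exists N => // n /= Nn.
  rewrite /rescaled_distance /truncated_distance min_l//.
  have := rateN n.+1 (leq_trans Nn (leqnSn n)).
  rewrite sub0r normrN gtr0_norm ?rate_gt0// => /ltW.
  by rewrite mulrC ler_pdivlMr ?rate_gt0// mul1r.
Qed.

(** Rescaling the distance by the inverse rate cancels the factor r(n+1), leaving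
a bound that does not depend on n. *)
Lemma coupled_wasserstein_le n (x y : E) :
  (wasserstein (rescaled_distance n) (P n.+1%:R x) (P n.+1%:R y) <=
    ((F1 (Num.max (mdist x x0) (mdist y x0)) +
      F2 (Num.max (mdist x x0) (mdist y x0))) * mdist x y)%:E)%E.
Proof.
have [gamma cpl gammaE] := cplP x y (ler0n R n.+1).
apply: (@le_trans _ _ (\int[gamma]_p (rescaled_distance n p.1 p.2)%:E)%E).
  by apply: ereal_inf_lbound; exists gamma.
apply: (le_trans (gammaE 1 _ ler01 _)); first by rewrite invr_ge0 ltW// rate_gt0.
have m0 := max_mdist_ge0 x y; set m := Num.max _ _ in m0 *.
rewrite lee_fin ler_wpM2r ?mdist_ge0// mul1r lerD2l.
rewrite mulrCA -[leRHS]mulr1 ler_wpM2l ?F2nd.1// mulrC ler_pdivrMr ?rate_gt0//.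
by rewrite mul1r /rate lerDl invr_ge0.
Qed.

Lemma coupled_asf : asf P.
Proof.
split; first exact: coupled_feller.
move=> x; exists (fun n => n.+1%:R), rescaled_distance; split => //.
  exact: rescaled_totally_separating.
have tr0 n y z : 0 <= rescaled_distance n y z.
  by apply: truncated_distance_ge0; rewrite ?invr_ge0 ?ltW ?rate_gt0.
apply/eqP; rewrite eq_le; apply/andP; split; last first.
  (* the supremum over U is at least its value at y = x, which is nonnegative *)
  apply: le_ereal_inf_tmp => _ [U [_ Ux] <-].
  apply: le_ereal_inf_tmp => _ [A [N _ NA] <-].
  apply: ereal_sup_ge; eexists; first by exists N => //; apply: NA => /=.
  apply: ereal_sup_ge; eexists; first by exists x.
  apply: le_ereal_inf_tmp => _ [gamma _ <-].
  by apply: integral_ge0 => p _; rewrite lee_fin.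
apply/lee_addgt0Pr => e e0; rewrite add0e.
pose rho := mdist x x0 + 1; pose C := F1 rho + F2 rho.
have rho0 : 0 <= rho by rewrite addr_ge0// mdist_ge0.
have C0 : 0 <= C by rewrite addr_ge0// ?F1nd.1 ?F2nd.1.
pose eta := Num.min 1 (e / (C + 1)).
have eta0 : 0 < eta by rewrite lt_min ltr01 divr_gt0// ltr_wpDl.
apply: ereal_inf_le; eexists.
  by exists ((ball x eta)°) => //; exact: (open_nbhs_ball x (PosNum eta0)).
(* the bound holds for every n, so the upper limit is at most the supremum *)
apply: ereal_inf_le; eexists; first by exists setT => //; exact: filterT.
apply: ge_ereal_sup => _ [n _ <-].
apply: ge_ereal_sup => _ [y /interior_subset + <-].
rewrite ballEmdist/= lt_min => /andP[xy1 xyC].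
apply: (le_trans (coupled_wasserstein_le n x y)).
have m0 := max_mdist_ge0 x y; set m := Num.max _ _ in m0 *.
have mrho : m <= rho.
  rewrite ge_max; apply/andP; split; rewrite /rho; first by rewrite lerDl.
  by have := metric_triangle y x x0; rewrite (metric_sym y x); lra.
rewrite lee_fin; apply: (@le_trans _ _ (C * mdist x y)).
  by rewrite ler_wpM2r ?mdist_ge0// lerD// ?F1nd.2 ?F2nd.2.
move: xyC; rewrite ltr_pdivlMr ?ltr_wpDl// => /ltW; apply: le_trans.
by rewrite mulrC ler_wpM2l ?mdist_ge0// lerDl.
Qed.

End from_couplings.
End consequences.

Theorem theorem2p5 (R : realType) (d : measure_display)
    (E : polishSpaceType d R) (P : R -> R.-pker E ~> E)
    (F1 F2 r : R -> R) (x0 : E) :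
  markov_semigroup P ->
  nonneg_nondecreasing F1 ->
  nonneg_nondecreasing F2 ->
  nonneg_nonincreasing r ->
  r t @[t --> +oo] --> (0 : R) ->
  (forall (x y : E) (t : R), 0 <= t ->
    exists (d' : measure_display) (Omega : measurableType d')
           (Pr : probability Omega R) (Y Z : {RV Pr >-> E}),
      [/\ forall A, measurable A -> distribution Pr Y A = P t y A,
          (total_variation_distance (distribution Pr Z) (P t x) <=
            (F1 (Num.max (mdist x x0) (mdist y x0)) * mdist x y)%:E)%E &
          ('E_Pr[fun w => mdist (Z w) (Y w)] <=
            (F2 (Num.max (mdist x x0) (mdist y x0)) * r t *
              mdist x y)%:E)%E]) ->
  asf_plus_with P (fun u => 2 * F1 u + F2 u) /\ asf P.
Proof.
move=> _ F1nd F2nd rni r0 copies.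
have cplP : coupled_at_rate P F1 F2 r x0.
  move=> x y t t0.
  have [d' [T [Pr [Y [Z [lawY tvZ dZY]]]]]] := copies x y t t0.
  have Px1 : P t x setT = 1%E by exact: prob_kernel.
  have [gamma cpl gammaE] := coupling_of_near_copies Px1 lawY tvZ dZY.
  exists gamma => // a b a0 b0; apply: (le_trans (gammaE a b a0 b0)).
  by rewrite mulrDl -!mulrA.
split; first exact: (coupled_asf_plus F1nd F2nd rni cplP r0).
exact: (coupled_asf F1nd F2nd rni cplP r0).
Qed.
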